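(* Let $K_2\in\mathbb{C}^{n_1n_2\times n_1n_2}$ be the matrix $$K_2=\frac{1}{\delta_y}\begin{bmatrix}-I_{n_1}&I_{n_1}&&&\\&-I_{n_1}&I_{n_1}&&\\&&\ddots&\ddots&\\&&&-I_{n_1}&I_{n_1}\\ e^{\imath2\pi\mathbf{k}\cdot\mathbf{a}_2}J_2&&&&-I_{n_1}\end{bmatrix}.$$ The eigenpairs of $K_2$ can be written as $$\big(\delta_y^{-1}(e^{\theta_{i,j}}-1),\ \mathbf{y}_{i,j}\otimes\mathbf{x}_i\big),\qquad i=1,\dots,n_1,\ j=1,\dots,n_2$$ (that is, these numbers are the eigenvalues of $K_2$, counted with multiplicity, with the indicated corresponding eigenvectors), where $\mathbf{x}_i=\begin{bmatrix}1&e^{\theta_i}&\cdots&e^{(n_1-1)\theta_i}\end{bmatrix}^\top$ with $\theta_i=\frac{\imath2\pi(i+\mathbf{k}\cdot\mathbf{a}_1)}{n_1}$, and $$\theta_{i,j}=\frac{\imath2\pi\left(j-\frac{m_1}{n_1}i+\mathbf{k}\cdot\hat{\mathbf{a}}_2\right)}{n_2}\quad\text{with}\quad\hat{\mathbf{a}}_2=\mathbf{a}_2-\frac{m_1}{n_1}\mathbf{a}_1+\rho_1\mathbf{a}_1,$$ $$\mathbf{y}_{i,j}=\begin{bmatrix}1&e^{\theta_{i,j}}&\cdots&e^{(n_2-1)\theta_{i,j}}\end{bmatrix}^\top.$$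
   Context: $\imath=\sqrt{-1}$ (distinct from the integer index $i$); $\mathbf{k}\in\mathbb{R}^3$ ($2\pi\mathbf{k}$ is the Bloch wave vector); $n_1,n_2$ are positive integers; $\otimes$ is the Kronecker product; $I_m$ the identity of order $m$. The lattice vectors are $\mathbf{a}_1=(\|\mathbf{a}_1\|,0,0)^\top$ and $\mathbf{a}_2=(\|\mathbf{a}_2\|\cos\theta_\gamma,\|\mathbf{a}_2\|\sin\theta_\gamma,0)^\top$, nonzero, with $0<\theta_\gamma<\pi$ and $\|\mathbf{a}_1\|\ge\|\mathbf{a}_2\|$; $\delta_x=\|\mathbf{a}_1\|/n_1$, $\delta_y=\|\mathbf{a}_2\|\sin\theta_\gamma/n_2$. The lattice is adapted to the grid: $m_1$ is an integer, $0\le m_1\le n_1$, with $m_1=\frac{\|\mathbf{a}_2\|\cos\theta_\gamma}{\delta_x}$ if $\cos\theta_\gamma\ge0$ and $m_1=\frac{\|\mathbf{a}_1\|+\|\mathbf{a}_2\|\cos\theta_\gamma}{\delta_x}$ if $\cos\theta_\gamma<0$. $\rho_1=\lceil\frac{2\theta_\gamma}{\pi}-1\rceil$, i.e. $\rho_1=0$ if $0<\theta_\gamma\le\frac\pi2$ and $\rho_1=1$ if $\frac\pi2<\theta_\gamma<\pi$. Finally $$J_2=e^{\imath2\pi\rho_1\mathbf{k}\cdot\mathbf{a}_1}\begin{bmatrix}0&e^{-\imath2\pi\mathbf{k}\cdot\mathbf{a}_1}I_{m_1}\\ I_{n_1-m_1}&0\end{bmatrix}\in\mathbb{C}^{n_1\times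 n_1}.$$ Equivalently, on block vectors $v=(v_1,\dots,v_{n_2})$ with $v_s\in\mathbb{C}^{n_1}$, $(K_2v)_s=\delta_y^{-1}(v_{s+1}-v_s)$ with $v_{n_2+1}:=e^{\imath2\pi\mathbf{k}\cdot\mathbf{a}_2}J_2v_1$. *)

(* Defs.v *)
From mathcomp Require Import all_boot all_order all_algebra.
From mathcomp Require Import complex mxtens.
From mathcomp Require Import reals sequences exp trigo.

Set Implicit Arguments.
Unset Strict Implicit.
Unset Printing Implicit Defensive.

Import Order.TTheory GRing.Theory Num.Theory.

Local Open Scope ring_scope.

Definition cexp (R : realType) (z : R[i]) : R[i] :=
  (expR (complex.Re z))%:C%C * Complex (cos (complex.Im z)) (sin (complex.Im z)).

Definition vec3 (R : realType) (x y z : R) : 'cV[R]_3 :=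
  \col_(i < 3) [:: x; y; z]`_i.

Definition dot (R : realType) (u v : 'cV[R]_3) : R := \sum_i u i 0 * v i 0.

(* The norm that MathComp-Analysis puts on matrices is the max norm, hence a
   separate Euclidean norm. *)
Definition enorm (R : realType) (u : 'cV[R]_3) : R := Num.sqrt (dot u u).

Definition delta_x (R : realType) (a1 : 'cV[R]_3) (n1 : nat) : R :=
  enorm a1 / n1%:R.

Definition delta_y (R : realType) (a2 : 'cV[R]_3) (thg : R) (n2 : nat) : R :=
  enorm a2 * sin thg / n2%:R.

Definition rho1 (R : realType) (thg : R) : int := Num.ceil (2 * thg / pi - 1).

(* e^(i 2 pi x) *)
Definition phase (R : realType) (x : R) : R[i] :=
  cexp ('i%C * (2 * pi * x)%:C%C).

(* The casts identify both m1 + (n1 - m1) and (n1 - m1) + m1 with n1. *)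
Definition J2 (R : realType) (k a1 : 'cV[R]_3) (thg : R) (n1 m1 : nat)
    (le_m1n1 : (m1 <= n1)%N) : 'M[R[i]]_n1 :=
  phase ((rho1 thg)%:~R * dot k a1) *:
    castmx (subnKC le_m1n1, subnK le_m1n1)
      (block_mx (0 : 'M_(m1, n1 - m1)) ((phase (- dot k a1))%:M : 'M_m1)
                (1%:M : 'M_(n1 - m1)) (0 : 'M_(n1 - m1, m1))).

(* The m x m array of n x n blocks B s t, with the same index convention as the
   Kronecker product *t. *)
Definition blocks_mx (T : Type) (m n : nat) (B : 'I_m -> 'I_m -> 'M[T]_n) :
    'M[T]_(m * n) :=
  \matrix_(p, q) B (mxtens_unindex p).1 (mxtens_unindex q).1
                   (mxtens_unindex p).2 (mxtens_unindex q).2.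

(* The blocks are added rather than chosen by cases, because for n2 = 1 the
   diagonal block and the corner block are the same one. *)
Definition K2 (R : realType) (k a1 a2 : 'cV[R]_3) (thg : R) (n1 n2 m1 : nat)
    (le_m1n1 : (m1 <= n1)%N) : 'M[R[i]]_(n2 * n1) :=
  ((delta_y a2 thg n2)^-1)%:C%C *:
    blocks_mx (fun s t : 'I_n2 =>
      (if t == s then - 1%:M else 0)
      + (if t == s.+1 :> nat then 1%:M else 0)
      + (if (s.+1 == n2) && (t == 0 :> nat)
         then phase (dot k a2) *: J2 k a1 thg le_m1n1 else 0)).

Definition theta (R : realType) (k a1 : 'cV[R]_3) (n1 i : nat) : R[i] :=
  'i%C * (2 * pi * (i%:R + dot k a1) / n1%:R)%:C%C.

Definition a2hat (R : realType) (a1 a2 : 'cV[R]_3) (thg : R) (n1 m1 : nat) :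
    'cV[R]_3 :=
  a2 - (m1%:R / n1%:R) *: a1 + (rho1 thg)%:~R *: a1.

Definition theta2 (R : realType) (k a1 a2 : 'cV[R]_3) (thg : R)
    (n1 n2 m1 i j : nat) : R[i] :=
  'i%C * (2 * pi * (j%:R - m1%:R / n1%:R * i%:R + dot k (a2hat a1 a2 thg n1 m1))
          / n2%:R)%:C%C.

Definition expvec (R : realType) (n : nat) (th : R[i]) : 'cV[R[i]]_n :=
  \col_(r < n) cexp (r%:R * th).

Definition lambda2 (R : realType) (k a1 a2 : 'cV[R]_3) (thg : R)
    (n1 n2 m1 i j : nat) : R[i] :=
  ((delta_y a2 thg n2)^-1)%:C%C * (cexp (theta2 k a1 a2 thg n1 n2 m1 i j) - 1).

Definition vec2 (R : realType) (k a1 a2 : 'cV[R]_3) (thg : R)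
    (n1 n2 m1 i j : nat) : 'cV[R[i]]_(n2 * n1) :=
  expvec n2 (theta2 k a1 a2 thg n1 n2 m1 i j) *t expvec n1 (theta k a1 n1 i).

(* MathComp's eigenvalue and eigenspace are about row vectors (v *m A). *)
Definition eigenpair (F : fieldType) (n : nat) (A : 'M[F]_n) (l : F)
    (v : 'cV[F]_n) : Prop :=
  v != 0 /\ A *m v = l *: v.

(* Main.v *)
Require Import Defs.
From mathcomp Require Import all_boot all_order all_algebra.
From mathcomp Require Import complex mxtens.
From mathcomp Require Import reals sequences exp trigo.
From mathcomp Require Import ring lra.

Set Implicit Arguments.
Unset Strict Implicit.
Unset Printing Implicit Defensive.

Import Order.TTheory GRing.Theory Num.Theory.

Local Open Scope ring_scope.

(** Here [phase x] is exp(2 pi i x) and [powers n z] is the column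
    (1, z, ..., z^(n-1)).  Every vector of the statement is a tensor product
    y *t x with y = [powers n2 w] and x = [powers n1 z], where w and z are
    phases.

    The eigenvalue equation.  The matrix J2 is, up to a scalar, a cyclic shift
    by m1 places whose wrapped entries are multiplied by phase (- k.a1).  Since
    z^n1 = phase (k.a1), the column x is invariant under that shift up to the
    factor z^(-m1) ([twisted_shift_powers]).  On a tensor y *t x all blocks of
    K2 then act on x as scalars, so K2 reduces to a scalar forward difference on
    y, closed by the factor mu through which phase (k.a2) J2 acts on x.  This
    difference multiplies [powers n2 w] by w - 1 as soon as w^n2 = mu
    ([twisted_difference_powers]).  The angle theta_(i,j) is a solution of this
    last equation, which is [J2_powers]; the term a2hat in it collects k.a2, the
    factor phase (rho1 k.a1) of J2 and the part of z^(-m1) that comes from k.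

    Completeness.  The eigenvalues may coincide for different (i, j), so the
    eigenvectors are proved independent by orthogonality instead: if i differs
    from i' then z / z' is a nontrivial n1-th root of unity, and if i = i' but j
    differs from j' then w / w' is a nontrivial n2-th root of unity; in both
    cases a factor of the Hermitian product is a vanishing geometric sum.  Hence
    the matrix of all n1 n2 vectors is invertible ([powers_tens_unitmx]), and
    both the characteristic polynomial and the basis follow. *)

(** * Matrices with an invertible matrix of eigenvectors *)

(** The columns of [P] conjugate [A] to the diagonal matrix of the [l q]; the
    determinant of [P], a nonzero constant, cancels from the characteristic
    polynomials. *)
Lemma char_poly_eigenbasis (F : fieldType) (n : nat) (A P : 'M[F]_n)
    (l : 'I_n -> F) :
  P \in unitmx -> (forall q, A *m col q P = l q *: col q P) ->
  char_poly A = \prod_q ('X - (l q)%:P).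
Proof.
move=> Pu AP; set D := diag_mx (\row_q l q).
have APD : A *m P = P *m D.
  apply/matrixP => p q; rewrite mul_mx_diag !mxE.
  have /colP/(_ p) := AP q; rewrite !mxE mulrC => <-.
  by apply: eq_bigr => r _; rewrite mxE.
have -> : char_poly A = char_poly D.
  pose C := map_mx (@polyC F).
  have /(congr1 determinant) :
      char_poly_mx A *m C _ _ P = C _ _ P *m char_poly_mx D.
    by rewrite mulmxBl mulmxBr scalar_mxC -!map_mxM APD.
  rewrite !det_mulmx [RHS]mulrC; apply: mulIf.
  by rewrite det_map_mx polyC_eq0 -unitfE -unitmxE.
rewrite char_poly_trig; last exact/diag_mx_is_trig.
by apply: eq_bigr => q _; rewrite !mxE eqxx mulr1n.
Qed.

Lemma basis_of_unitmx (F : fieldType) (n : nat) (P : 'M[F]_n)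
    (X : seq 'cV[F]_n) :
  P \in unitmx -> (forall q, col q P \in X) -> size X = n ->
  basis_of fullv X.
Proof.
move=> Pu PX sX; rewrite basisEdim sX dimvf /dim /= muln1 leqnn andbT.
apply/subvP => u _; rewrite -(mulKVmx Pu u); set c := invmx P *m u.
have -> : P *m c = \sum_q c q 0 *: col q P.
  apply/colP => p; rewrite summxE !mxE; apply: eq_bigr => q _.
  by rewrite !mxE mulrC.
by apply: memv_suml => q _; rewrite memvZ ?memv_span.
Qed.

(** * Orthogonality of columns of powers *)

Lemma sum_unity_root (F : fieldType) (n : nat) (w : F) :
  w ^+ n = 1 -> w != 1 -> \sum_(r < n) w ^+ r = 0.
Proof.
move=> wn w1; have /eqP := subrX1 w n.
by rewrite wn subrr eq_sym mulf_eq0 subr_eq0 (negPf w1) => /eqP.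
Qed.

Definition powers (F : fieldType) (n : nat) (z : F) : 'cV[F]_n :=
  \col_(r < n) z ^+ r.

(** When the [y p] and the [x p] have modulus 1, the hypothesis on roots of unity
    makes the columns orthogonal.  The conjugate transpose is written here with
    inverses, which makes the argument purely algebraic: the product of the two
    matrices is the scalar m n, and this is nonzero in characteristic 0. *)
Lemma powers_tens_unitmx (F : numFieldType) (m n : nat)
    (y x : 'I_(m * n) -> F) :
  (forall p, y p != 0) -> (forall p, x p != 0) ->
  (forall p q, p != q ->
     ((y q / y p) ^+ m = 1 /\ y q / y p != 1)
     \/ ((x q / x p) ^+ n = 1 /\ x q / x p != 1)) ->
  \matrix_(r, q) (powers m (y q) *t powers n (x q)) r 0 \in unitmx.
Proof.
move=> y0 x0 yx; set P := \matrix_(_, _) _.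
pose Q : 'M_(m * n) := \matrix_(p, r)
  ((y p)^-1 ^+ (mxtens_unindex r).1 * (x p)^-1 ^+ (mxtens_unindex r).2).
have QP : Q *m P = (m * n)%:R%:M.
  apply/matrixP => p q; rewrite !mxE.
  transitivity ((\sum_(s < m) (y q / y p) ^+ s)
                * (\sum_(t < n) (x q / x p) ^+ t)).
    rewrite mulr_sum; apply: eq_bigr => r _; rewrite !mxE !exprMn; ring.
  have [<-|pq] := eqVneq p q.
    have sum1 k : \sum_(r < k) 1 ^+ r = k%:R :> F.
      by under eq_bigr do rewrite expr1n; rewrite sumr_const card_ord.
    by rewrite !divff // !sum1 -natrM.
  rewrite mulr0n.
  by case: (yx _ _ pq) => -[w1 w]; rewrite (sum_unity_root w1 w) ?mul0r ?mulr0.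
rewrite unitmxE unitfE; apply/eqP => detP; have /eqP := congr1 determinant QP.
rewrite det_mulmx detP mulr0 det_scalar eq_sym expf_eq0 pnatr_eq0.
by case: (m * n)%N.
Qed.

(** * Twisted cyclic differences and shifts *)

(** This reduces the action of K2 on y *t x to that of a scalar matrix on y: all
    the blocks have the eigenvector x in common. *)
Lemma blocks_mx_tens (F : fieldType) (m n : nat) (B : 'I_m -> 'I_m -> 'M[F]_n)
    (b : 'M[F]_m) (y : 'cV_m) (x : 'cV_n) :
  (forall s t, B s t *m x = b s t *: x) ->
  blocks_mx B *m (y *t x) = (b *m y) *t x.
Proof.
move=> Bx; apply/colP => p; rewrite !mxE.
set s := (mxtens_unindex p).1; set r := (mxtens_unindex p).2.
transitivity (\sum_t \sum_q B s t r q * (y t 0 * x q 0)).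
  rewrite pair_big /= (reindex (@mxtens_unindex m n)) /=.
    by apply: eq_bigr => q _; rewrite !mxE !ord1.
  by exists (@mxtens_index m n) => q _; rewrite ?mxtens_indexK ?mxtens_unindexK.
rewrite !ord1 mulr_suml; apply: eq_bigr => t _.
have /colP/(_ r) := Bx s t; rewrite !mxE => Bxr.
by rewrite mulrAC -Bxr mulr_suml; apply: eq_bigr => q _; rewrite mulrA mulrAC.
Qed.

(** The powers of [y] are an eigenvector of the forward difference inside the
    range; the hypothesis says that the value [J *m x] which the last row meets
    in place of the missing next block is the one that continues the sequence. *)
Lemma twisted_difference_powers (F : fieldType) (m n : nat) (J : 'M[F]_n)
    (x : 'cV_n) (y : F) :
  J *m x = y ^+ m *: x ->
  blocks_mx (fun s t : 'I_m =>
      (if t == s then - 1%:M else 0)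
      + (if t == s.+1 :> nat then 1%:M else 0)
      + (if (s.+1 == m) && (t == 0 :> nat) then J else 0))
    *m (powers m y *t x)
  = (y - 1) *: (powers m y *t x).
Proof.
move=> Jx.
pose b : 'M[F]_m := \matrix_(s, t)
  ((if t == s then - 1 else 0) + (if t == s.+1 :> nat then 1 else 0)
      + (if (s.+1 == m) && (t == 0 :> nat) then y ^+ m else 0)).
rewrite (@blocks_mx_tens _ _ _ _ b) => [|s t]; last first.
  rewrite !mxE !mulmxDl !scalerDl; congr (_ + _ + _); case: ifP => _;
  by rewrite ?mulNmx ?mul1mx ?mul0mx ?scaleN1r ?scale1r ?scale0r.
suff -> : b *m powers m y = (y - 1) *: powers m y.
  by apply/colP => p; rewrite !mxE mulrA.
apply/colP => s; rewrite !mxE.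
under eq_bigr do
  rewrite !mxE !mulrDl !(fun_if (fun c => c * _)) !mul0r mulN1r mul1r.
rewrite !big_split /= -!big_mkcond /= big_pred1_eq -addrA addrC mulrBl mul1r.
(* Exactly one of the two remaining sums is nonempty: the second term of the
   difference inside the range, the corner block in the last row. *)
congr (_ - _); rewrite -exprS; have [sm|sm] := ltnP s.+1 m.
  rewrite (big_pred1 (Ordinal sm)) //= big1 ?addr0 // => t /andP[/eqP sm'].
  by rewrite sm' ltnn in sm.
have {}sm : s.+1 = m by apply/eqP; rewrite eqn_leq sm ltn_ord.
have m0 : (0 < m)%N by rewrite -sm.
rewrite big1 ?add0r => [|t /eqP tm]; last by have := ltn_ord t; rewrite tm sm ltnn.
by rewrite (big_pred1 (Ordinal m0)) => [|t] /=; rewrite sm ?eqxx // mulr1.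
Qed.

Lemma castmx_col_mx_fun (T : Type) (f : nat -> T) (m n p : nat)
    (e : (m + n = p)%N) :
  castmx (e, erefl) (col_mx (\col_(r < m) f r) (\col_(r < n) f (m + r)%N))
  = \col_(r < p) f r.
Proof.
case: _ / e; apply/colP => r; rewrite castmxE cast_ord_id !mxE.
by case: split_ordP => i -> /=; rewrite !mxE.
Qed.

Lemma castmx_mulmx (R : pzRingType) (m m' n n' p : nat) (em : m = m')
    (en : n = n') (A : 'M[R]_(m, n)) (B : 'M_(n, p)) :
  castmx (em, en) A *m castmx (en, erefl) B = castmx (em, erefl) (A *m B).
Proof. by case: _ / em; case: _ / en. Qed.

(** Shifting a geometric progression by [m] places divides it by [z ^+ m].  The
    entries that wrap around are off by a factor [z ^+ n], which [c] cancels. *)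
Lemma twisted_shift_powers (F : fieldType) (m n : nat) (le_mn : (m <= n)%N)
    (c z : F) :
  z != 0 -> c * z ^+ n = 1 ->
  castmx (subnKC le_mn, subnK le_mn)
    (block_mx (0 : 'M_(m, n - m)) (c%:M : 'M_m)
              (1%:M : 'M_(n - m)) (0 : 'M_(n - m, m))) *m powers n z
  = z ^- m *: powers n z.
Proof.
move=> z0 czn; have zm0 : z ^+ m != 0 by rewrite expf_neq0.
rewrite -{1}[powers n z](castmx_col_mx_fun (fun r => z ^+ r) (subnK le_mn)).
rewrite castmx_mulmx mul_block_col !mul0mx add0r addr0 mul_scalar_mx mul1mx.
have -> : z ^- m *: powers n z = \col_(r < n) (z ^- m * z ^+ r).
  by apply/colP => r; rewrite !mxE.
rewrite -(castmx_col_mx_fun (fun r => z ^- m * z ^+ r) (subnKC le_mn)).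
congr (castmx _ (col_mx _ _)); apply/colP => r; rewrite !mxE.
  apply: (mulfI zm0); rewrite mulVKf // mulrCA -exprD addnA subnKC //.
  by rewrite exprD mulrA czn mul1r.
by rewrite exprD mulKf.
Qed.

(** * Phases *)

Lemma phaseE (R : realType) (x : R) :
  phase x = Complex (cos (2 * pi * x)) (sin (2 * pi * x)).
Proof.
rewrite /phase /cexp /=; simpc.
by rewrite expR0 !mul1r.
Qed.

Lemma phase0 (R : realType) : phase (0 : R) = 1.
Proof. by rewrite phaseE mulr0 cos0 sin0. Qed.

Lemma phaseD (R : realType) (x y : R) : phase (x + y) = phase x * phase y.
Proof.
by rewrite !phaseE mulrDr cosD sinD; simpc; congr Complex; rewrite addrC.
Qed.

Lemma phase_neq0 (R : realType) (x : R) : phase x != 0.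
Proof.
apply: contra_eq_neq (phase0 R) => x0.
by rewrite -(subrr x) phaseD x0 mul0r eq_sym oner_eq0.
Qed.

Lemma phaseN (R : realType) (x : R) : phase (- x) = (phase x)^-1.
Proof.
apply: (mulfI (phase_neq0 x)).
by rewrite -phaseD subrr phase0 divff // phase_neq0.
Qed.

Lemma phase_natM (R : realType) (n : nat) (x : R) :
  phase (n%:R * x) = phase x ^+ n.
Proof.
elim: n => [|n IHn]; first by rewrite mul0r phase0.
by rewrite -natr1 mulrDl mul1r phaseD IHn exprSr.
Qed.

Lemma phase_nat (R : realType) (n : nat) : phase (n%:R : R) = 1.
Proof.
rewrite -(mulr1 n%:R) phase_natM phaseE mulr1 mulr_natl.
by rewrite cos2pi sin2pi expr1n.
Qed.

(** The real part of the phase is 1 - 2 sin^2 (pi x), and sin is positive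
    on ]0, pi[. *)
Lemma phase_neq1 (R : realType) (x : R) : 0 < x < 1 -> phase x != 1.
Proof.
case/andP=> x0 x1; apply/eqP; rewrite phaseE => -[+ _].
have -> : 2 * pi * x = (pi * x) *+ 2 by rewrite mulr2n; ring.
rewrite cos_mulr2n cos2sin2.
have : 0 < sin (pi * x).
  by apply: sin_gt0_pi; rewrite mulr_gt0 ?pi_gt0 //= gtr_pMr ?pi_gt0.
by move=> s0; have := exprn_gt0 2 s0; lra.
Qed.

(** This is where the two ranges 1..n1 and 1..n2 of the indices matter: a
    difference of two indices in a range of length [n] is never a nonzero
    multiple of [n]. *)
Lemma phase_frac_root (R : realType) (n i j : nat) (x y : R) :
  (i < n)%N -> (j < n)%N -> i != j ->
  x - y = (i%:R - j%:R) / n%:R ->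
  (phase x / phase y) ^+ n = 1 /\ phase x / phase y != 1.
Proof.
move=> lt_in lt_jn ij xy.
have n0 : (0 < n)%N by apply: leq_ltn_trans lt_in.
have nR : n%:R != 0 :> R by rewrite pnatr_eq0 -lt0n.
wlog lt_ji : i j x y lt_in lt_jn ij xy / (j < i)%N.
  move=> wlg; have [lt_ji|lt_ij|/eqP] := ltngtP j i.
  - exact: wlg lt_ji.
  - have yx : y - x = (j%:R - i%:R) / n%:R by rewrite -opprB xy -mulNr opprB.
    rewrite eq_sym in ij; have [r1 r] := wlg _ _ _ _ lt_jn lt_in ij yx lt_ij.
    by rewrite -invf_div exprVn r1 invr1 invr_eq1.
  - by rewrite eq_sym (negPf ij).
rewrite -phaseN -phaseD xy -natrB 1?ltnW //; split.
  by rewrite -phase_natM mulrC divfK // phase_nat.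
apply: phase_neq1; rewrite divr_gt0 ?ltr0n ?subn_gt0 //=.
by rewrite ltr_pdivrMr ?ltr0n // mul1r ltr_nat (leq_ltn_trans (leq_subr _ _)).
Qed.

(** * Eigenvectors of K2 *)

Lemma expvecE (R : realType) (n : nat) (th : R[i]) (u : R) :
  th = 'i%C * (2 * pi * u)%:C%C -> expvec n th = powers n (phase u).
Proof.
move=> ->; apply/colP => r; rewrite !mxE -phase_natM /phase.
congr cexp; rewrite mulrCA; congr (_ * _).
rewrite -[r%:R in LHS](rmorph_nat (real_complex R)) -[RHS]/(real_complex R _).
rewrite -rmorphM; congr (_%:C)%C; ring.
Qed.

(** The angles [theta] and [theta2] measured in turns, i.e. divided by 2 pi i. *)
Definition theta_turns (R : realType) (k a1 : 'cV[R]_3) (n1 i : nat) : R :=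
  (i%:R + dot k a1) / n1%:R.

Definition theta2_turns (R : realType) (k a1 a2 : 'cV[R]_3) (thg : R)
    (n1 n2 m1 i j : nat) : R :=
  (j%:R - m1%:R / n1%:R * i%:R + dot k (a2hat a1 a2 thg n1 m1)) / n2%:R.

Lemma cexp_theta2 (R : realType) (k a1 a2 : 'cV[R]_3) (thg : R)
    (n1 n2 m1 i j : nat) :
  cexp (theta2 k a1 a2 thg n1 n2 m1 i j)
  = phase (theta2_turns k a1 a2 thg n1 n2 m1 i j).
Proof. by rewrite /phase mulrA. Qed.

Lemma vec2E (R : realType) (k a1 a2 : 'cV[R]_3) (thg : R)
    (n1 n2 m1 i j : nat) :
  vec2 k a1 a2 thg n1 n2 m1 i j
  = powers n2 (phase (theta2_turns k a1 a2 thg n1 n2 m1 i j))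
    *t powers n1 (phase (theta_turns k a1 n1 i)).
Proof.
rewrite /vec2 (expvecE _ (u := theta2_turns k a1 a2 thg n1 n2 m1 i j)).
  by rewrite (expvecE _ (u := theta_turns k a1 n1 i)) // mulrA.
by rewrite mulrA.
Qed.

Lemma dot_a2hat (R : realType) (k a1 a2 : 'cV[R]_3) (thg : R) (n1 m1 : nat) :
  dot k (a2hat a1 a2 thg n1 m1)
  = dot k a2 - m1%:R / n1%:R * dot k a1 + (rho1 thg)%:~R * dot k a1.
Proof.
rewrite /dot !mulr_sumr -sumrB -big_split; apply: eq_bigr => s _ /=.
by rewrite !mxE; ring.
Qed.

(** The defining equation of the angle [theta2]: its exponential is an n2-th root
    of the eigenvalue of [phase (dot k a2) *: J2].  The summand [j] only selects
    the root, since [phase j%:R = 1]. *)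
Lemma J2_powers (R : realType) (k a1 a2 : 'cV[R]_3) (thg : R)
    (n1 n2 m1 i j : nat) (le_m1n1 : (m1 <= n1)%N) :
  (0 < n1)%N -> (0 < n2)%N ->
  (phase (dot k a2) *: J2 k a1 thg le_m1n1)
    *m powers n1 (phase (theta_turns k a1 n1 i))
  = phase (theta2_turns k a1 a2 thg n1 n2 m1 i j) ^+ n2
      *: powers n1 (phase (theta_turns k a1 n1 i)).
Proof.
move=> n1_gt0 n2_gt0.
have n1R : n1%:R != 0 :> R by rewrite pnatr_eq0 -lt0n.
have n2R : n2%:R != 0 :> R by rewrite pnatr_eq0 -lt0n.
rewrite /J2 -!scalemxAl twisted_shift_powers ?phase_neq0 //; last first.
  rewrite -phase_natM -phaseD /theta_turns mulrC divfK //.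
  by rewrite addrC addrK phase_nat.
rewrite !scalerA; congr (_ *: _).
rewrite -!phase_natM -phaseN -!phaseD.
set u := theta_turns _ _ _ _; set w := theta2_turns _ _ _ _ _ _ _ _ _.
have -> : n2%:R * w = j%:R + (dot k a2 + (rho1 thg)%:~R * dot k a1 - m1%:R * u).
  by rewrite /w /u /theta2_turns /theta_turns dot_a2hat; field; rewrite n1R n2R.
by rewrite [RHS]phaseD phase_nat mul1r.
Qed.

Lemma K2_eigenvector (R : realType) (k a1 a2 : 'cV[R]_3) (thg : R)
    (n1 n2 m1 i j : nat) (le_m1n1 : (m1 <= n1)%N) :
  (0 < n1)%N -> (0 < n2)%N ->
  K2 k a1 a2 thg n2 le_m1n1 *m vec2 k a1 a2 thg n1 n2 m1 i j
  = lambda2 k a1 a2 thg n1 n2 m1 i j *: vec2 k a1 a2 thg n1 n2 m1 i j.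
Proof.
move=> n1_gt0 n2_gt0; rewrite /K2 /lambda2 cexp_theta2 vec2E.
rewrite -scalemxAl twisted_difference_powers; first by rewrite scalerA.
exact: J2_powers.
Qed.

(** The vectors are listed in the order in which [*t] numbers its entries, so that
    the first component of an index stands for j - 1 and the second for i - 1. *)
Lemma vec2_unitmx (R : realType) (k a1 a2 : 'cV[R]_3) (thg : R)
    (n1 n2 m1 : nat) :
  (0 < n1)%N -> (0 < n2)%N ->
  \matrix_(r, q) vec2 k a1 a2 thg n1 n2 m1 (mxtens_unindex q).2.+1
                      (mxtens_unindex q).1.+1 r 0 \in unitmx.
Proof.
move=> n1_gt0 n2_gt0.
under eq_mx do rewrite vec2E.
apply: powers_tens_unitmx => [q|q|p q pq]; try exact: phase_neq0.
(* The angle [theta2] depends on i too, so that it is compared only when the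
   two values of i agree. *)
have [eq2|ne2] := eqVneq (mxtens_unindex q).2 (mxtens_unindex p).2.
  left; rewrite eq2; apply: (phase_frac_root (i := (mxtens_unindex q).1)
                                             (j := (mxtens_unindex p).1)) => //.
  - apply: contra_neq pq => /val_inj eq1.
    apply: (can_inj (@mxtens_unindexK n2 n1)).
    by rewrite [LHS]surjective_pairing [RHS]surjective_pairing eq1 eq2.
  - by rewrite /theta2_turns -mulrBl -!natr1; congr (_ / _); ring.
right; apply: (phase_frac_root (i := (mxtens_unindex q).2)
                               (j := (mxtens_unindex p).2)) => //.
by rewrite /theta_turns -mulrBl -!natr1; congr (_ / _); ring.
Qed.

Theorem theorem4p2 (R : realType) (k a1 a2 : 'cV[R]_3) (thg : R)
    (n1 n2 m1 : nat)
    (n1_gt0 : (0 < n1)%N) (n2_gt0 : (0 < n2)%N)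
    (thg_gt0 : 0 < thg) (thg_lt_pi : thg < pi)
    (a1_neq0 : a1 != 0) (a2_neq0 : a2 != 0)
    (a1E : a1 = vec3 (enorm a1) 0 0)
    (a2E : a2 = vec3 (enorm a2 * cos thg) (enorm a2 * sin thg) 0)
    (le_a2a1 : enorm a2 <= enorm a1)
    (le_m1n1 : (m1 <= n1)%N)
    (m1E_pos : 0 <= cos thg ->
       m1%:R = enorm a2 * cos thg / delta_x a1 n1)
    (m1E_neg : cos thg < 0 ->
       m1%:R = (enorm a1 + enorm a2 * cos thg) / delta_x a1 n1) :
  [/\ forall i j : nat, (1 <= i <= n1)%N -> (1 <= j <= n2)%N ->
        eigenpair (K2 k a1 a2 thg n2 le_m1n1)
          (lambda2 k a1 a2 thg n1 n2 m1 i j) (vec2 k a1 a2 thg n1 n2 m1 i j),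
      char_poly (K2 k a1 a2 thg n2 le_m1n1) =
        \prod_(1 <= i < n1.+1) \prod_(1 <= j < n2.+1)
          ('X - (lambda2 k a1 a2 thg n1 n2 m1 i j)%:P)
    & basis_of fullv
        [seq vec2 k a1 a2 thg n1 n2 m1 i j | i <- iota 1 n1, j <- iota 1 n2]].
Proof.
have Pu := vec2_unitmx k a1 a2 thg m1 n1_gt0 n2_gt0.
set P := \matrix_(_, _) _ in Pu.
have Pcol q : col q P = vec2 k a1 a2 thg n1 n2 m1 (mxtens_unindex q).2.+1
                             (mxtens_unindex q).1.+1.
  by apply/colP => r; rewrite !mxE.
split.
- move=> i j _ _; split; last exact: K2_eigenvector.
  (* The first entry of every vector is 1. *)
  have m0 : (0 < n2 * n1)%N by rewrite muln_gt0 n2_gt0.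
  apply/eqP => /colP/(_ (Ordinal m0)); rewrite vec2E !mxE /=.
  by rewrite div0n mod0n mulr1 => /eqP; rewrite oner_eq0.
- rewrite (char_poly_eigenbasis Pu (l := fun q => lambda2 k a1 a2 thg n1 n2 m1
             (mxtens_unindex q).2.+1 (mxtens_unindex q).1.+1)) => [|q]; last first.
    by rewrite Pcol K2_eigenvector.
  rewrite exchange_big /= big_add1 big_mkord.
  under [RHS]eq_bigr do rewrite big_add1 big_mkord.
  rewrite pair_big /= [RHS](reindex (@mxtens_unindex n2 n1)) //=.
  by exists (@mxtens_index n2 n1) => q _; rewrite ?mxtens_indexK ?mxtens_unindexK.
- apply: (basis_of_unitmx Pu) => [q|]; last first.
    by rewrite size_allpairs !size_iota mulnC.
  rewrite Pcol allpairs_f // mem_iota add1n ltnS.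
    exact: ltn_ord (mxtens_unindex q).2.
  exact: ltn_ord (mxtens_unindex q).1.
Qed.
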